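(* Let $\Bbbk$ be a field of characteristic $0$ and let $n\ge 2$. Let $K_n$ be the complete graph on the vertex set $[n]=\{1,\dots,n\}$. Then the algebra $A_{\mathrm c}(K_n)$ has the strong Lefschetz property (SLP).
   Context: A vertex cover of a graph $G$ is a set of vertices meeting every edge. For a finite simple graph $G$ on $[n]$, let $R=\Bbbk[x_1,\dots,x_n]$ with the standard grading, $x_C=\prod_{i\in C}x_i$, $J(G)=(x_C : C\text{ a vertex cover of }G)\subset R$, and $A_{\mathrm c}(G)=R/\big((x_1^2,\dots,x_n^2)+J(G)\big)$. A standard graded Artinian $\Bbbk$-algebra $A=\bigoplus_i[A]_i$ has the SLP if there is a linear form $\ell\in[A]_1$ such that for all $i\ge0$ and $q\ge1$ the multiplication map $\cdot\ell^q:[A]_i\to[A]_{i+q}$ has maximal rank (is injective or surjective). *)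

(* Defs.v *)
(* boolp is used only to turn ideal membership into a boolean predicate, as
   required by the quotients of ring_quotient. *)
From HB Require Import structures.
From mathcomp Require Import all_boot all_algebra.
From mathcomp Require Import boolp.
From mathcomp Require Import mpoly.

Set Implicit Arguments.
Unset Strict Implicit.
Unset Printing Implicit Defensive.

Import GRing.Theory.

Local Open Scope ring_scope.
Local Open Scope quotient_scope.

(* The structure idealr of ring_quotient only covers proper ideals, whereas
   the ideals below may contain 1 (when the graph has no edge), so we allow the
   unit ideal and the zero ring. *)
Record ideal (R : comNzRingType) := Ideal {
  ideal_pred :> R -> bool;
  ideal_zmod_closed : zmod_closed ideal_pred;
  ideal_mull : forall a x : R, ideal_pred x -> ideal_pred (a * x)
}.

HB.instance Definition _ (R : comNzRingType) (I : ideal R) :=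
  GRing.isZmodClosed.Build R (ideal_pred I) (ideal_zmod_closed I).

Definition ideal_zmodClosed (R : comNzRingType) (I : ideal R) : zmodClosed R :=
  GRing.ZmodClosed.clone R (ideal_pred I) _.

Section GeneratedIdeal.
Variables (R : comNzRingType) (S : R -> Prop).

Definition in_span (x : R) : Prop :=
  exists s : seq (R * R),
    (forall p, p \in s -> S p.2) /\ x = \sum_(p <- s) p.1 * p.2.

Definition ideal_gen_pred (x : R) : bool := asbool (in_span x).

Lemma ideal_gen_mull a x : ideal_gen_pred x -> ideal_gen_pred (a * x).
Proof.
move=> /asboolP[s [Ss ->]]; apply/asboolP.
exists [seq (a * p.1, p.2) | p <- s]; split=> [p /mapP[r rs ->]|].
  exact: Ss rs.
by rewrite big_map mulr_sumr; apply: eq_bigr => p _; rewrite mulrA.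
Qed.

Lemma ideal_gen_zmod_closed : zmod_closed ideal_gen_pred.
Proof.
split=> [|x y xI yI].
  by apply/asboolP; exists [::]; split=> //; rewrite big_nil.
have /asboolP[t [St Dt]] := ideal_gen_mull (-1) yI.
have /asboolP[s [Ss ->]] := xI.
apply/asboolP; exists (s ++ t); split=> [p|].
  by rewrite mem_cat => /orP[/Ss|/St].
by rewrite big_cat /= -Dt mulN1r.
Qed.

Definition ideal_gen : ideal R := Ideal ideal_gen_zmod_closed ideal_gen_mull.

End GeneratedIdeal.

Section IdealSum.
Variables (R : comNzRingType) (I J : ideal R).

Definition ideal_add_pred (x : R) : bool :=
  asbool (exists a b : R, [/\ I a, J b & x = a + b]).

Lemma ideal_add_mull a x : ideal_add_pred x -> ideal_add_pred (a * x).
Proof.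
move=> /asboolP[b [c [Ib Jc ->]]]; apply/asboolP.
by exists (a * b), (a * c); split; rewrite ?mulrDr //; apply: ideal_mull.
Qed.

Lemma ideal_add_zmod_closed : zmod_closed ideal_add_pred.
Proof.
split=> [|_ _ /asboolP[a [b [Ia Jb ->]]] /asboolP[c [d [Ic Jd ->]]]].
  apply/asboolP; exists 0, 0; rewrite addr0.
  by split=> //; apply: (proj1 (ideal_zmod_closed _)).
apply/asboolP; exists (a - c), (b - d); rewrite opprD addrACA.
by split=> //; apply: (proj2 (ideal_zmod_closed _)).
Qed.

Definition ideal_add : ideal R := Ideal ideal_add_zmod_closed ideal_add_mull.

End IdealSum.

Section QuotientRing.
Variables (R : comNzRingType) (I : ideal R).

Definition quotient_ring : Type := Quotient.quot (ideal_zmodClosed I).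

HB.instance Definition _ := GRing.Zmodule.on quotient_ring.
HB.instance Definition _ := EqQuotient.on quotient_ring.

Definition quotient_proj (x : R) : quotient_ring := \pi_(quotient_ring) x.

Definition quotient_one : quotient_ring := quotient_proj 1.
Definition quotient_mul (x y : quotient_ring) : quotient_ring :=
  quotient_proj (repr x * repr y).

Lemma quotient_projP x y : quotient_proj x = quotient_proj y <-> I (x - y).
Proof.
split=> [/eqP|h]; first by rewrite -(Quotient.idealrBE (ideal_zmodClosed I)).
by apply/eqP; rewrite -(Quotient.idealrBE (ideal_zmodClosed I)).
Qed.

Lemma quotient_reprK x : quotient_proj (repr x) = x.
Proof. exact: reprK. Qed.

Lemma quotient_projD x y :
  quotient_proj (x + y) = quotient_proj x + quotient_proj y.
Proof. by rewrite /quotient_proj (Quotient.pi_add (ideal_zmodClosed I)). Qed.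

Lemma quotient_projM x y :
  quotient_proj (x * y) = quotient_mul (quotient_proj x) (quotient_proj y).
Proof.
apply/quotient_projP.
have Ix : I (x - repr (quotient_proj x)).
  by apply/quotient_projP; rewrite quotient_reprK.
have Iy : I (y - repr (quotient_proj y)).
  by apply/quotient_projP; rewrite quotient_reprK.
set x' := repr _ in Ix *; set y' := repr _ in Iy *.
have -> : x * y - x' * y' = y * (x - x') - x' * (y' - y).
  by rewrite !mulrBr opprB [y * x]mulrC [y * x']mulrC addrA subrK.
apply: (proj2 (ideal_zmod_closed I)); apply: ideal_mull => //.
rewrite -opprB -mulN1r; exact: ideal_mull.
Qed.

Fact quotient_mulA : associative quotient_mul.
Proof.
move=> x y z; rewrite -[x]quotient_reprK -[y]quotient_reprK -[z]quotient_reprK.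
by rewrite -!quotient_projM mulrA.
Qed.

Fact quotient_mulC : commutative quotient_mul.
Proof. by move=> x y; rewrite /quotient_mul mulrC. Qed.

Fact quotient_mul1 : left_id quotient_one quotient_mul.
Proof.
by move=> x; rewrite -[x]quotient_reprK -quotient_projM mul1r.
Qed.

Fact quotient_mulDl : left_distributive quotient_mul +%R.
Proof.
move=> x y z; rewrite -[x]quotient_reprK -[y]quotient_reprK -[z]quotient_reprK.
by rewrite -quotient_projD -!quotient_projM -quotient_projD mulrDl.
Qed.

HB.instance Definition _ := GRing.Zmodule_isComPzRing.Build quotient_ring
  quotient_mulA quotient_mulC quotient_mul1 quotient_mulDl.

End QuotientRing.

Section PolynomialQuotient.
Variables (k : fieldType) (n : nat) (I : ideal {mpoly k[n]}).

Definition quotient_scale (a : k) (x : quotient_ring I) : quotient_ring I :=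
  quotient_proj I a%:MP * x.

Fact quotient_scaleA a b x :
  quotient_scale a (quotient_scale b x) = quotient_scale (a * b) x.
Proof.
rewrite /quotient_scale mulrA mpolyCM; congr (_ * _).
by rewrite (quotient_projM I).
Qed.

Fact quotient_scale1 : left_id 1 quotient_scale.
Proof. by move=> x; rewrite /quotient_scale mpolyC1 mul1r. Qed.

Fact quotient_scaleDr : right_distributive quotient_scale +%R.
Proof. by move=> a x y; rewrite /quotient_scale mulrDr. Qed.

Fact quotient_scaleDl x : {morph quotient_scale^~ x : a b / a + b}.
Proof.
by move=> a b; rewrite /quotient_scale mpolyCD quotient_projD mulrDl.
Qed.

(* MathComp's lalgType/algType require 1 != 0, so the k-algebra R/I is given by
   its commutative ring structure together with this k-module structure. *)
HB.instance Definition _ := GRing.Zmodule_isLmodule.Build k (quotient_ring I)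
  quotient_scaleA quotient_scale1 quotient_scaleDr quotient_scaleDl.

(* [R/I]_d for a homogeneous ideal I *)
Definition quotient_part (d : nat) (x : quotient_ring I) : Prop :=
  exists2 f : {mpoly k[n]}, f \is d.-homog & x = quotient_proj I f.

End PolynomialQuotient.

Definition maximal_rank (A B : Type) (U : A -> Prop) (V : B -> Prop)
    (f : A -> B) : Prop :=
  (forall x y, U x -> U y -> f x = f y -> x = y) \/
  (forall z, V z -> exists2 x, U x & f x = z).

(* Apart is the grading: Apart d x means that x lies in [A]_d *)
Definition has_SLP (A : comPzRingType) (Apart : nat -> A -> Prop) : Prop :=
  exists2 l : A, Apart 1%N l &
    forall i q : nat, (1 <= q)%N ->
      maximal_rank (Apart i) (Apart (i + q)%N) (fun x => l ^+ q * x).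

Record simple_graph (n : nat) := SimpleGraph {
  adj :> rel 'I_n;
  adj_sym : forall i j, adj i j = adj j i;
  adj_irr : irreflexive adj
}.

Definition vertex_cover (n : nat) (G : simple_graph n) (C : {set 'I_n}) : Prop :=
  forall i j, G i j -> i \in C \/ j \in C.

Definition complete_adj (n : nat) : rel 'I_n := fun i j => i != j.

Fact complete_adj_sym n (i j : 'I_n) : complete_adj i j = complete_adj j i.
Proof. by rewrite /complete_adj eq_sym. Qed.

Fact complete_adj_irr n : irreflexive (@complete_adj n).
Proof. by move=> i; rewrite /complete_adj eqxx. Qed.

Definition complete_graph (n : nat) : simple_graph n :=
  SimpleGraph (@complete_adj_sym n) (@complete_adj_irr n).

Section CoverAlgebra.
Variables (k : fieldType) (n : nat) (G : simple_graph n).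

Definition cover_ideal : ideal {mpoly k[n]} :=
  ideal_gen (fun f =>
    exists2 C : {set 'I_n}, vertex_cover G C & f = \prod_(i in C) 'X_i).

Definition squares_ideal : ideal {mpoly k[n]} :=
  ideal_gen (fun f => exists i : 'I_n, f = 'X_i ^+ 2).

Definition cover_algebra : Type :=
  quotient_ring (ideal_add squares_ideal cover_ideal).

HB.instance Definition _ := GRing.ComPzRing.on cover_algebra.
HB.instance Definition _ := GRing.Lmodule.on cover_algebra.

Definition cover_algebra_part : nat -> cover_algebra -> Prop :=
  @quotient_part k n (ideal_add squares_ideal cover_ideal).

End CoverAlgebra.

(* Main.v *)
Require Import Defs.
From mathcomp Require Import all_boot all_algebra.
From mathcomp Require Import boolp mpoly zify.

(* The vertex covers of K_n are the sets with at least n - 1 elements, so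
   A_c(K_n) has as a basis the squarefree monomials x_S with |S| <= n - 2, and
   all higher parts vanish. For l = x_1 + ... + x_n, the map l^q is, up to the
   factor q!, the inclusion matrix between i-sets and (i+q)-sets. In
   characteristic 0 this matrix is injective when 2i + q <= n, because the sums
   of a function on i-sets over the i-subsets of every large enough set
   determine it; taking complements and transposing, it is surjective when
   2i + q >= n. *)

Set Implicit Arguments.
Unset Strict Implicit.
Unset Printing Implicit Defensive.

Import GRing.Theory.

Local Open Scope ring_scope.

(* Summing over the points removed from B counts each S once per point of
   B :\: S. *)
Lemma sum_setD1_subsets (V : nmodType) (T : finType)
    (f : {set T} -> V) i (B : {set T}) :
  \sum_(x in B) \sum_(S : {set T} | (#|S| == i) && (S \subset B :\ x)) f S =
  (\sum_(S : {set T} | (#|S| == i) && (S \subset B)) f S) *+ (#|B| - i).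
Proof.
rewrite -sumrMnl.
rewrite (exchange_big_dep
  (fun S : {set T} => (#|S| == i) && (S \subset B))) /=; last first.
  by move=> x S _ /andP[->]; rewrite subsetD1 => /andP[].
apply: eq_bigr => S /andP[/eqP <- sSB].
rewrite (eq_bigl (mem (B :\: S))) => [|x]; last first.
  by rewrite !inE subsetD1 sSB eqxx andbC.
by rewrite sumr_const cardsD (setIidPr sSB).
Qed.

Lemma natr_eq0_pchar0 (k : idomainType) m :
  [pchar k] =i pred0 -> (m%:R == 0 :> k) = (m == 0)%N.
Proof. by move/GRing.pcharf0P. Qed.

(** * Rank of the inclusion matrices in characteristic 0 *)

Section InclusionMatrix.
Variables (k : fieldType) (T : finType).
Hypothesis pchar0 : [pchar k] =i pred0.
Implicit Types (A B C D S : {set T}) (f : {set T} -> k).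

(** Induction on [#|B|]: by [sum_setD1_subsets], [#|B| - i] times the sum over [B] is a sum of
    vanishing sums over the sets [B :\ x]. Once [j < #|B|], this factor is a positive integer, so it
    is nonzero in [k]. *)
Lemma subset_sums_eq0_up f i j :
    (i <= j)%N ->
    (forall B, #|B| = j ->
      \sum_(S : {set T} | (#|S| == i) && (S \subset B)) f S = 0) ->
  forall B, (j <= #|B|)%N ->
    \sum_(S : {set T} | (#|S| == i) && (S \subset B)) f S = 0.
Proof.
move=> le_ij f0 B; have [m] := ubnP #|B|; elim: m B => // m IHm B leBm.
rewrite leq_eqVlt => /predU1P[/esym|lt_jB]; first exact: f0.
have /eqP := sum_setD1_subsets f i B; rewrite big1 => [|x Bx].
  rewrite eq_sym -mulr_natr mulf_eq0 natr_eq0_pchar0 // subn_eq0.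
  case/orP=> [/eqP->//|].
  by rewrite leqNgt (leq_ltn_trans le_ij lt_jB).
by move: leBm lt_jB; rewrite (cardsD1 x B) Bx !ltnS; apply: IHm.
Qed.

(** Inclusion-exclusion, one point of [D] at a time. For [x] in [D], the sum for [D :\ x] splits
    according to whether [S] contains [x]. The sets without [x] form the sum for [D :\ x] and
    [x |: A]; moving [x] from [D] to [A] does not increase [#|A| + #|D|], so induction kills that
    part. *)
Lemma subset_sums_eq0_pinned f i :
    (forall A, (#|A| <= i)%N ->
      \sum_(S : {set T} | (#|S| == i) && (S \subset ~: A)) f S = 0) ->
  forall D A, (#|A| + #|D| <= i)%N ->
    \sum_(S : {set T} | [&& #|S| == i, D \subset S & S \subset ~: A]) f S = 0.
Proof.
move=> f0 D; have [m] := ubnP #|D|; elim: m D => // m IHm D ltDm A leADi.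
have [D0 | [x Dx]] := set_0Vmem D.
  rewrite -[RHS](f0 A) ?(leq_trans (leq_addr _ _) leADi) //.
  by apply: eq_bigl => S; rewrite D0 sub0set.
have cardD: #|D| = #|D :\ x|.+1 by rewrite (cardsD1 x) Dx.
rewrite cardD ltnS in ltDm; rewrite cardD in leADi.
have: \sum_(S : {set T} |
    [&& #|S| == i, D :\ x \subset S & S \subset ~: A]) f S = 0.
  by apply: IHm => //; rewrite (leq_trans _ leADi) ?leq_add2l.
rewrite (bigID (fun S : {set T} => x \in S)) /=.
rewrite [X in _ + X = _ -> _](_ : _ = 0); last first.
  rewrite -[RHS](IHm (D :\ x) ltDm (x |: A)); last first.
    rewrite (leq_trans _ leADi) // addnS -addSn leq_add2r cardsU1.
    by case: (x \in A).
  apply: eq_bigl => S; rewrite setCU subsetI.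
  rewrite [S \subset ~: [set x]]subsetC sub1set inE.
  by rewrite -!andbA; congr [&& _, _ & _]; rewrite andbC.
rewrite addr0 => sumDx0; rewrite -[RHS]sumDx0; apply: eq_bigl => S.
rewrite -{1}(setD1K Dx) subUset sub1set -!andbA.
by case: (x \in S); rewrite ?andbT ?andbF ?andTb.
Qed.

Lemma inclusion_injective f i j :
    (i <= j)%N -> (i + j <= #|T|)%N ->
    (forall B, #|B| = j ->
      \sum_(S : {set T} | (#|S| == i) && (S \subset B)) f S = 0) ->
  forall S, #|S| = i -> f S = 0.
Proof.
move=> le_ij le_ijT f0 C cardC.
have f0C A: (#|A| <= i)%N ->
    \sum_(S : {set T} | (#|S| == i) && (S \subset ~: A)) f S = 0.
  move=> leAi; apply: (subset_sums_eq0_up le_ij f0).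
  by rewrite -(leq_add2l #|A|) cardsC (leq_trans _ le_ijT) ?leq_add2r.
(* With all [i] points of [C] pinned, [C] is the only set left in the sum. *)
rewrite -[RHS](subset_sums_eq0_pinned f0C (D := C) (A := set0)); last first.
  by rewrite cards0 cardC.
rewrite (big_pred1 C) // => S /=; rewrite setC0 subsetT andbT.
apply/andP/eqP => [[/eqP cardS sCS]|->]; last by rewrite cardC eqxx.
by apply/eqP; rewrite eq_sym eqEcard sCS cardS cardC /=.
Qed.

(** The row space of a matrix is the annihilator of its kernel. The columns of [cokermx] lie in that
    kernel, so they are enough as test vectors [w]. *)
Lemma fredholm (I J : finType) (M : I -> J -> k) (v : J -> k) :
    (forall w, (forall s, \sum_t M s t * w t = 0) -> \sum_t v t * w t = 0) ->
  exists u, forall t, \sum_s u s * M s t = v t.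
Proof.
move=> orth_v.
pose M' := \matrix_(s < #|I|, t < #|J|) M (enum_val s) (enum_val t).
pose v' := \row_(t < #|J|) v (enum_val t).
have /submxP[u Du]: (v' <= M')%MS.
  rewrite submxE; apply/eqP/rowP => c; rewrite !mxE.
  rewrite -[RHS](orth_v (fun t => cokermx M' (enum_rank t) c)) => [|s].
    rewrite [RHS](reindex _ (onW_bij _ (enum_val_bij J))) /=.
    by apply: eq_bigr => t _; rewrite mxE enum_valK.
  have /matrixP/(_ (enum_rank s) c) := mulmx_coker M'; rewrite !mxE => M'w0.
  rewrite -[RHS]M'w0 [LHS](reindex _ (onW_bij _ (enum_val_bij J))) /=.
  apply: eq_bigr => t _.
  by rewrite !mxE enum_valK enum_rankK.
exists (fun s => u 0 (enum_rank s)) => t.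
have /rowP/(_ (enum_rank t)) := Du; rewrite !mxE enum_rankK => ->.
rewrite [LHS](reindex _ (onW_bij _ (enum_val_bij I))) /=; apply: eq_bigr => s _.
by rewrite mxE enum_valK enum_rankK.
Qed.

Lemma inclusion_surjective (c : {set T} -> k) i j :
    (i <= j)%N -> (#|T| <= i + j)%N -> (j <= #|T|)%N ->
  exists u : {set T} -> k, forall B, #|B| = j ->
    \sum_(S : {set T} | (#|S| == i) && (S \subset B)) u S = c B.
Proof.
move=> le_ij le_Tij le_jT.
pose M S B : k := [&& #|S| == i, #|B| == j & S \subset B]%:R.
(* The columns of [M] off the [j]-sets are zero, so the target is cut to zero there too. *)
have [w Mw0|u Du] :=
  fredholm (M := M) (v := fun B => c B *+ (#|B| == j)); last first.
  exists u => B cardB; have := Du B; rewrite cardB eqxx mulr1n => <-.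
  rewrite big_mkcond; apply: eq_bigr => S _; rewrite /M cardB eqxx /=.
  by case: ifP; rewrite ?mulr1 ?mulr0.
suff w0 B: #|B| = j -> w B = 0.
  by apply: big1 => B _; case: eqP => [/w0->|_]; rewrite ?mulr0 ?mul0r.
move=> cardB; rewrite -[B]setCK.
(* Complementation reverses inclusion, so [Mw0] becomes the vanishing of subset sums of [f] for the
   sizes [#|T| - j] and [#|T| - i]. These add up to at most [#|T|] because [#|T| <= i + j]. *)
pose f A := w (~: A); rewrite -/(f (~: B)).
have cardC A : #|~: A| = (#|T| - #|A|)%N by rewrite -(cardsC A) addKn.
apply: (@inclusion_injective f (#|T| - j) (#|T| - i));
  rewrite ?cardC ?cardB ?leq_sub2l //.
  by lia.
move=> A cardA; rewrite -[RHS](Mw0 (~: A)).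
rewrite [RHS](reindex_inj (@setC_inj T)) big_mkcond /=.
apply: eq_bigr => S _.
rewrite /M /f setCS !cardC cardA subKn ?(leq_trans le_ij) // eqxx /=.
have -> : (#|S| == #|T| - j)%N = (#|T| - #|S| == j)%N.
  by have := max_card S; lia.
by case: ifP; rewrite ?mul1r ?mul0r.
Qed.

End InclusionMatrix.

(** * Squarefree monomials and powers of the sum of the variables *)

Section SquarefreeCoefficients.
Variables (R : comNzRingType) (n : nat).
Implicit Types (p f g : {mpoly R[n]}) (S T : {set 'I_n}).

Lemma mcoeffMX_le p (a m : 'X_{1..n}) :
  (p * 'X_[a])@_m = if (a <= m)%MM then p@_(m - a) else 0.
Proof.
case: ifPn => [le_am | nle_am].
  by rewrite -{1}(submK le_am) addmC mcoeffMX.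
apply/memN_msupp_eq0; rewrite (perm_mem (msuppMX p a)).
by apply: contra nle_am => /mapP[m' _ ->]; apply: lem_addr.
Qed.

Lemma mesym1_le S T : (mesym1 S <= mesym1 T)%MM = (S \subset T).
Proof.
apply/mnm_lepP/subsetP => le_ST i; have := le_ST i; rewrite !mnmE.
  by case: (i \in S); case: (i \in T).
by case: (i \in S) => // /(_ isT) ->.
Qed.

Lemma mesym1D1 S i : i \in S -> (mesym1 S - U_(i))%MM = mesym1 (S :\ i).
Proof.
move=> Si; apply/mnmP => j; rewrite !mnmE !inE eq_sym.
by case: eqP => [->|_]; rewrite ?Si ?subn0.
Qed.

Lemma prodX_mesym1 S : \prod_(i in S) 'X_i = 'X_[mesym1 S] :> {mpoly R[n]}.
Proof.
rewrite mprodXE; congr 'X_[_]; apply/mnmP=> i.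
rewrite mnmE mnm_sumE big_mkcond (bigD1 i) //= mnmE eqxx.
rewrite big1 ?addn0 => [|j ne_ji].
  by case: (i \in S).
by case: ifP; rewrite // mnmE (negbTE ne_ji).
Qed.

Lemma squarefree_monomialP (m : 'X_{1..n}) :
  (exists i, (U_(i) *+ 2 <= m)%MM) \/ exists S, m = mesym1 S.
Proof.
have [/existsP[i mi]|] := boolP [exists i, (2 <= m i)%N].
  left; exists i; apply/mnm_lepP => j; rewrite mulmnE mnm1E.
  by case: eqP => [<-|]; rewrite ?mul1n.
rewrite negb_exists => /forallP m_le1; right; exists [set i | m i != 0%N].
by apply/mnmP => i; rewrite mnmE inE; have := m_le1 i; case: (m i) => [|[]].
Qed.

Definition sumX : {mpoly R[n]} := \sum_(i < n) 'X_i.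

(** The factor [q!] counts the orders in which the points of [T :\: S] can be removed. In the
    induction, each new linear factor removes one point of [T], and [sum_setD1_subsets] contributes
    [#|T| - i], which is [q.+1]. *)
Lemma mcoeff_sumX_exp q f i T : #|T| = (i + q)%N ->
  (sumX ^+ q * f)@_(mesym1 T) =
  (\sum_(S : {set 'I_n} | (#|S| == i) && (S \subset T)) f@_(mesym1 S)) *+ q`!.
Proof.
elim: q T => [|q IHq] T cardT.
  rewrite expr0 mul1r (big_pred1 T) // => S /=; rewrite addn0 in cardT.
  apply/andP/eqP => [[/eqP cardS sST]|->]; last by rewrite cardT eqxx.
  by apply/eqP; rewrite eqEcard sST cardS cardT /=.
rewrite exprS -mulrA mulr_suml raddf_sum /=.
transitivity (\sum_(x in T) (sumX ^+ q * f)@_(mesym1 (T :\ x))).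
  rewrite [RHS]big_mkcond; apply: eq_bigr => x _.
  rewrite mulrC mcoeffMX_le -{1}mesym1_set1 mesym1_le sub1set.
  by case: ifP => // Tx; rewrite mesym1D1.
transitivity (\sum_(x in T)
    (\sum_(S : {set 'I_n} | (#|S| == i) && (S \subset T :\ x))
        f@_(mesym1 S)) *+ q`!).
  apply: eq_bigr => x Tx; apply: IHq.
  by move: cardT; rewrite (cardsD1 x) Tx addnS => -[].
by rewrite sumrMnl sum_setD1_subsets cardT addKn -mulrnA factS.
Qed.

End SquarefreeCoefficients.

(** * The defining ideal for the complete graph *)

Lemma vertex_cover_complete n (C : {set 'I_n}) :
  vertex_cover (complete_graph n) C <-> (n <= #|C|.+1)%N.
Proof.
(* A set is a cover exactly when its complement is independent; in [K_n] an independent set has at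
   most one vertex. *)
have -> : (n <= #|C|.+1)%N = (#|~: C| <= 1)%N.
  by have := cardsC C; rewrite card_ord; lia.
split=> [covC | /card_le1_eqP inj i j ne_ij].
  apply/card_le1_eqP => i j; rewrite !inE => nCi nCj; apply/eqP.
  by apply: contraT => /covC[]; rewrite ?(negbTE nCi) ?(negbTE nCj).
apply/orP; apply: contraNT ne_ij; rewrite negb_or => /andP[nCi nCj].
by apply/eqP/inj; rewrite inE.
Qed.

Section CompleteCoverIdeal.
Variables (k : fieldType) (n : nat).
Implicit Types (f g : {mpoly k[n]}) (S : {set 'I_n}).

Let I := ideal_add (squares_ideal k n) (cover_ideal k (complete_graph n)).

(** The ideal is generated by monomials, so membership is decided monomial by monomial. The
    monomials outside it are the squarefree ones whose support is too small to contain a cover. *)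
Lemma cover_idealP f :
  I f <-> forall S, (#|S|.+1 < n)%N -> f@_(mesym1 S) = 0.
Proof.
split=> [/asboolP[a [b [/asboolP[s [Ds ->]] /asboolP[t [Dt ->]] ->]]] | f0].
  move=> S ltSn.
  rewrite mcoeffD !raddf_sum !big_seq !big1 ?addr0 //= => p.
    case/Dt=> C /vertex_cover_complete leCn ->.
    rewrite prodX_mesym1 mcoeffMX_le mesym1_le.
    by case: ifP => // /subset_leq_card; lia.
  case/Ds=> i ->; rewrite mpolyXn mcoeffMX_le; case: ifP => // /mnm_lepP/(_ i).
  by rewrite mulmnE mnm1E mnmE eqxx; case: (_ \in _).
have zero_in (J : ideal {mpoly k[n]}) : J 0 by case: (ideal_zmod_closed J).
have Isq g : squares_ideal k n g -> I g.
  by move=> sq_g; apply/asboolP; exists g, 0; rewrite addr0.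
have Icov g : cover_ideal k (complete_graph n) g -> I g.
  by move=> cov_g; apply/asboolP; exists 0, g; rewrite add0r.
have gen (P : {mpoly k[n]} -> Prop) g : P g -> ideal_gen P g.
  move=> Pg; apply/asboolP; exists [:: (1, g)]; rewrite big_seq1 mul1r.
  split=> // p.
  by rewrite inE => /eqP ->.
suff: f \in ideal_pred I by [].
rewrite [f]mpolyE; apply: rpred_sum => m _; rewrite -mul_mpolyC.
(* A monomial is divisible by a square, or has a cover as its support, or has coefficient zero in
   [f] by [f0]. *)
case: (squarefree_monomialP m) => [[i le_im] | [S ->]].
  rewrite -(submK le_im) mpolyXD mulrA; apply/ideal_mull/Isq/gen.
  by exists i; rewrite mpolyXn.
case: (ltnP #|S|.+1 n) => [/f0->|leSn]; first by rewrite mul0r rpred0.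
apply/ideal_mull/Icov/gen; exists S; last by rewrite prodX_mesym1.
exact/vertex_cover_complete.
Qed.

End CompleteCoverIdeal.

(** * Maximal rank of the multiplication maps *)

Theorem proposition3p6 (k : fieldType) (hk : [pchar k] =i pred0)
    (n : nat) (hn : (2 <= n)%N) :
  @has_SLP (cover_algebra k (complete_graph n))
    (@cover_algebra_part k n (complete_graph n)).
Proof.
set I := ideal_add (squares_ideal k n) (cover_ideal k (complete_graph n)).
pose pi : {mpoly k[n]} -> cover_algebra k (complete_graph n) := quotient_proj I.
have piM f g : pi f * pi g = pi (f * g) by rewrite /pi quotient_projM.
have piX f q : pi f ^+ q = pi (f ^+ q).
  by elim: q => // q IHq; rewrite !exprS IHq piM.
have homX : sumX k n \is 1.-homog.
  by apply: rpred_sum => i _; rewrite dhomogX /= mdeg1.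
have homXq f i q : f \is i.-homog -> sumX k n ^+ q * f \is (i + q).-homog.
  move=> homf; rewrite addnC dhomogM //.
  by have := dhomogMn q homX; rewrite mul1n.
have coef0 (f : {mpoly k[n]}) d (S : {set 'I_n}) :
    f \is d.-homog -> #|S| != d -> f@_(mesym1 S) = 0.
  by move=> homf neSd; apply: dhomog_nemf_coeff homf _; rewrite /= mdeg_mesym1.
exists (pi (sumX k n)) => [|i q q_gt0]; first by exists (sumX k n).
(* If [i + q] is at least [n - 1], the target part is zero and the map is trivially surjective.
   Otherwise no squarefree coefficient of degree [i + q] is lost in the quotient. *)
have [le_n|lt_n] := leqP n (i + q).+1.
  right=> _ [f homf ->]; exists (pi 0); first by exists 0; first exact: rpred0.
  rewrite piX piM mulr0; apply/esym/quotient_projP/cover_idealP => S ltSn.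
  rewrite subr0.
  by apply: coef0 homf _; apply: contraTneq ltSn => ->; rewrite -leqNgt.
have fact_neq0 : q`!%:R != 0 :> k.
  by rewrite natr_eq0_pchar0 // -lt0n fact_gt0.
have [le_iiq_n|lt_n_iiq] := leqP (i + (i + q)) n.
  left=> _ _ [f homf ->] [g homg ->].
  rewrite !piX !piM => /quotient_projP/cover_idealP; rewrite -mulrBr => fg0.
  have homfg : f - g \is i.-homog by rewrite rpredB.
  apply/quotient_projP/cover_idealP => S _.
  have [cardS|] := eqVneq #|S| i; last exact: coef0.
  apply: (inclusion_injective hk (f := fun S => (f - g)@_(mesym1 S))
    (leq_addr q i)) cardS.
    by rewrite card_ord.
  (* The coefficient at [B] is [q!] times a subset sum of [f - g], and [q!] is invertible. *)
  move=> B cardB; have := fg0 B; rewrite cardB (mcoeff_sumX_exp _ cardB).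
  move=> /(_ lt_n)/eqP.
  by rewrite -mulr_natr mulf_eq0 (negbTE fact_neq0) orbF => /eqP.
right=> _ [g homg ->].
have [||u Du] :=
  (* Dividing by [q!] compensates for the factor from [mcoeff_sumX_exp]. The solution [u] then gives
     the squarefree coefficients of a preimage. *)
  inclusion_surjective hk (fun B => g@_(mesym1 B) / q`!%:R) (leq_addr q i).
- by rewrite card_ord ltnW.
- by rewrite card_ord; lia.
pose f := \sum_(S : {set 'I_n} | #|S| == i) u S *: 'X_[mesym1 S] : {mpoly k[n]}.
have homf : f \is i.-homog.
  by apply: rpred_sum => S cardS; rewrite rpredZ // dhomogX /= mdeg_mesym1.
have coeff (S : {set 'I_n}) : #|S| == i -> f@_(mesym1 S) = u S.
  move=> cardS; rewrite raddf_sum (bigD1 S) //= mcoeffZ mcoeffX eqxx mulr1.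
  rewrite big1 ?addr0 // => C /andP[_ neCS].
  by rewrite mcoeffZ mcoeffX (inj_eq (@inj_mesym1 n)) (negbTE neCS) mulr0.
exists (pi f); first by exists f.
rewrite piX piM; apply/quotient_projP/cover_idealP => B _.
have [cardB|] := eqVneq #|B| (i + q)%N; last first.
  by apply: coef0; rewrite rpredB ?homXq.
rewrite mcoeffB (mcoeff_sumX_exp _ cardB).
rewrite (eq_bigr u) => [|S /andP[/coeff]] //.
by rewrite Du // -[X in X - _]mulr_natr divfK // subrr.
Qed.
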